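(* Let $w$ be a decreasing weight on the unit disc $\mathbb{D}$ with $0<w(0)<\infty$. Then $w\in B_\infty$.
   Context: $\mathbb{D}=\{z\in\mathbb{C}:|z|<1\}$ carries normalized area measure and $\mathbb{T}=\{|z|=1\}$ carries normalized arc length measure; $|\cdot|$ denotes these measures. $I\subset\mathbb{T}$ always means that $I$ is an interval (arc) of $\mathbb{T}$ of positive length, possibly all of $\mathbb{T}$. The Carleson square of $I$ is $Q_I=\{z\in\mathbb{D}\setminus\{0\}: z/|z|\in I,\ 1-|z|<|I|\}$. For measurable $f$ on $\mathbb{D}$, $Mf(z)=\sup_{I\subset\mathbb{T}:\,z\in Q_I}\frac{1}{|Q_I|}\int_{Q_I}|f|$. A weight on $\mathbb{D}$ is a measurable $w:\mathbb{D}\to[0,\infty]$ with $0<w<\infty$ a.e. An integrable weight $w$ is in $B_\infty$ if there is $C>0$ with $\int_{Q_I}M(w1_{Q_I})\le C\int_{Q_I}w$ for all $I\subset\mathbb{T}$. A weight $w$ is decreasing if it is radial, i.e. $w(z)=f(|z|)$ for all $z\in\mathbb{D}$ for some measurable $f:[0,1)\to[0,\infty]$, and $f$ is decreasing in the weak (non-strict) sense. *)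

(* Defs.v *)
From HB Require Import structures.
From mathcomp Require Import all_boot all_order all_algebra.
From mathcomp Require Import all_classical all_reals all_analysis.
From mathcomp Require Import measurable_realfun.

Set Implicit Arguments.
Unset Strict Implicit.
Unset Printing Implicit Defensive.

Import Order.TTheory GRing.Theory Num.Theory.
Import numFieldNormedType.Exports.

Local Open Scope classical_set_scope.
Local Open Scope ring_scope.

(* The complex plane is represented as [R * R] with the product of the Borel
   sigma-algebras ([measurableTypeR R] is [R] with the structure on which
   [lebesgue_measure] is defined). *)
Definition plane (R : realType) :=
  (measurableTypeR R * measurableTypeR R)%type.

(* The norm [`|z|] of the library on a product is the sup norm. *)
Definition modulus (R : realType) (z : plane R) : R :=
  Num.sqrt (z.1 ^+ 2 + z.2 ^+ 2).

Definition disc (R : realType) : set (plane R) := [set z | modulus z < 1].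

(* z / |z|; only meaningful for z != 0. *)
Definition direction (R : realType) (z : plane R) : plane R :=
  (z.1 / modulus z, z.2 / modulus z).

(* t |-> e^(i t) *)
Definition cis (R : realType) (t : R) : plane R := (cos t, sin t).

Lemma inv_pi_ge0 (R : realType) : 0 <= (pi : R)^-1.
Proof. by rewrite invr_ge0 pi_ge0. Qed.

(* Area measure normalized so that the disc, of Lebesgue measure pi, has
   measure 1.  It is a measure on the whole plane; it is only ever used on
   subsets of the disc. *)
Definition area (R : realType) :
    {measure set (plane R) -> \bar R} :=
  mscale (NngNum (inv_pi_ge0 R))
    ((@lebesgue_measure R) \x (@lebesgue_measure R))%E.

(* Normalized arc length: the image under [cis] of Lebesgue measure on
   [0, 2 pi[, divided by 2 pi. *)
Definition arc_length (R : realType) (I : set (plane R)) : \bar R :=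
  ((2 * pi)^-1%:E * lebesgue_measure (`[0%R, (2 * pi)%R[ `&` @cis R @^-1` I))%E.

(* Intervals of the circle are the images under [cis] of the intervals (open,
   closed, half-open, bounded or not) of the real line; an interval of the line
   longer than 2 pi gives the whole circle. *)
Definition is_arc (R : realType) (I : set (plane R)) : Prop :=
  (exists J : interval R, I = @cis R @` [set` J]) /\ (0 < arc_length I)%E.

Definition carleson_square (R : realType) (I : set (plane R)) : set (plane R) :=
  [set z | [/\ disc z, z != (0, 0), I (direction z)
             & ((1 - modulus z)%:E < arc_length I)%E]].

Definition carleson_average (R : realType) (f : plane R -> \bar R)
    (I : set (plane R)) : \bar R :=
  ((area R (carleson_square I))^-1
     * \int[area R]_(z in carleson_square I) `|f z|)%E.

(* The supremum is taken in [0, +oo]: [0] is added so that it is [0], instead of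
   [-oo], at the points lying in no Carleson square (in the disc, only the
   origin). *)
Definition maximal (R : realType) (f : plane R -> \bar R) (z : plane R) : \bar R :=
  ereal_sup (0%E |` [set carleson_average f I | I in
    [set I | is_arc I /\ carleson_square I z]]).

(* Only the values of [w] on the disc matter, here and below. *)
Definition weight (R : realType) (w : plane R -> \bar R) : Prop :=
  [/\ measurable_fun (disc (R:=R)) w,
      forall z, disc z -> (0 <= w z)%E
    & {ae area R, forall z, disc z -> (0 < w z < +oo)%E}].

(* [w \_ A] is the product of [w] with the indicator function of [A]. *)
Definition B_infty (R : realType) (w : plane R -> \bar R) : Prop :=
  [/\ weight w,
      (area R).-integrable (disc (R:=R)) w
    & exists2 C : R, 0 < C & forall I : set (plane R), is_arc I ->
        let Q := carleson_square I in
        (\int[area R]_(z in Q) maximal (w \_ Q) z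
           <= C%:E * \int[area R]_(z in Q) w z)%E].

Definition decreasing (R : realType) (w : plane R -> \bar R) : Prop :=
  exists f : R -> \bar R,
    [/\ measurable_fun (`[0%R, 1%R[ : set R) f,
        forall r, 0 <= r < 1 -> (0 <= f r)%E,
        forall r s, 0 <= r -> r <= s -> s < 1 -> (f s <= f r)%E
      & forall z, disc z -> w z = f (modulus z)].

(* Main.v *)
Require Import Defs.
From mathcomp Require Import all_boot all_order all_algebra.
From mathcomp Require Import all_classical all_reals all_analysis.
From mathcomp Require Import measurable_realfun.
From mathcomp Require Import ring lra.

Set Implicit Arguments.
Unset Strict Implicit.
Unset Printing Implicit Defensive.

Import Order.TTheory GRing.Theory Num.Theory.
Import numFieldNormedType.Exports.

Local Open Scope classical_set_scope.
Local Open Scope ring_scope.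

(** Write Q_I for the Carleson square of an arc I. The constant C = 1 works,
    because of the pointwise bound

      M (w 1_{Q_I}) <= (1/|Q_I|) int_{Q_I} w       on the whole plane.

    To see this, take any arc J. In polar coordinates Q_I and Q_J are products
    of an arc and of an interval of radii ending at 1, so their intersection is
    the product of (I meet J) and of the shorter interval of radii. If J is the
    shorter arc, the average of w 1_{Q_I} over Q_J is at most the radial average
    of w over the radii of Q_J; these radii are the ones of Q_I closest to 1,
    where the decreasing weight w is smallest, so this is at most the radial
    average over the radii of Q_I. If J is the longer arc, Q_J contains the
    product of (I meet J) and of the radii of Q_I, on which all the mass of
    w 1_{Q_I} in Q_J lies and where its average is the radial average over the
    radii of Q_I. The cases are combined in [decreasing_mass_le]. Integrating
    the constant bound over Q_I gives the B_infty inequality, and w is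
    integrable because it is bounded by w(0) on a set of finite area.

    Polar coordinates enter only through a product formula. The set of the
    points whose direction lies in an arc is a cone, invariant under dilations,
    and a dilation of ratio k multiplies areas by k^2. Hence, for a cone C,
    the image of the area on C by z |-> |z|^2 gives mass x |C meet D| to [0, x[
    for x <= 1, so it is |C meet D| times Lebesgue measure on [0, 1[
    ([area_sector], [integral_sector]). The squared modulus is the right radial
    variable: it makes the radial measure uniform, and the statement about
    averages becomes a one-dimensional inequality for decreasing functions on
    [0, 1[ ([tail_integral_le]). No relation between |C meet D| and the length
    of the arc is involved, beyond monotonicity in C. *)

(** * Measurability of cones *)

Definition normsq (R : realType) (z : plane R) : R := z.1 ^+ 2 + z.2 ^+ 2.

(** The sigma-algebra of the plane is generated by products of Borel sets; an
    open set is a countable union of rational squares. *)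
Lemma measurable_open_plane (R : realType) (U : set (R * R)) :
  open U -> measurable (U : set (plane R)).
Proof.
move=> oU.
pose box (p : rat * rat * nat) : set (plane R) :=
  ball (ratr p.1.1 : R) p.2.+1%:R^-1 `*` ball (ratr p.1.2 : R) p.2.+1%:R^-1.
have -> : U = \bigcup_p (if `[< box p `<=` U >] then box p else set0).
  apply/seteqP; split=> [z Uz|z [p _]]; last first.
    by case: ifPn => // /asboolP pU /pU.
  have /nbhs_ballP[e /= e0 eU] : nbhs z U by exact: oU.
  (* a rational square of half side d about a rational point d-close to z
     contains z and stays within distance 2 d < e of it *)
  pose d : R := (Num.truncn (2 / e)).+1%:R^-1.
  have d0 : 0 < d by rewrite invr_gt0.
  have de : d < e / 2.
    rewrite /d invf_plt ?posrE ?divr_gt0// invf_div; exact: truncnS_gt.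
  have near_rat (x : R) : exists q : rat, `|x - ratr q| < d.
    have /rat_in_itvoo[q] : x < x + d by rewrite ltrDl.
    rewrite in_itv/= => /andP[xq qd]; exists q.
    by rewrite distrC ger0_norm ?subr_ge0 ?(ltW xq)// ltrBlDl.
  have [q1 q1z] := near_rat z.1; have [q2 q2z] := near_rat z.2.
  exists (q1, q2, Num.truncn (2 / e)) => //; rewrite -/d.
  case: ifPn => [_|/asboolP]; first by split; rewrite /ball/= distrC.
  move=> notsub; exfalso; apply: notsub => y [/= y1 y2]; apply: eU.
  have tri (a b c : R) : `|a - b| < d -> `|b - c| < d -> `|a - c| < e.
    move=> ab bc; rewrite -(subrKA b) (le_lt_trans (ler_normD _ _))//.
    by rewrite (splitr e) ltrD// (lt_trans _ de).
  by split; [exact: tri q1z y1|exact: tri q2z y2].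
apply: countable_bigcupT_measurable => // p; case: ifPn => // _.
by apply: measurableX; exact: measurable_ball.
Qed.

Lemma measurable_compact_plane (R : realType) (K : set (R * R)) :
  compact K -> measurable (K : set (plane R)).
Proof.
move=> cK; rewrite -(setCK K); apply: measurableC.
apply: (@measurable_open_plane _ (~` K)).
apply: closed_openC; apply: compact_closed cK.
exact: norm_hausdorff.
Qed.

(** The end points of the segments are rationals, or the bounds of the interval
    when these are attained: an end point that belongs to the interval need not
    be rational. *)
Lemma interval_bigcup_segment (R : realType) (A : set R) : is_interval A ->
  exists F : option rat * option rat -> R * R,
    A = \bigcup_(p in [set p | `[(F p).1, (F p).2]%classic `<=` A])
      `[(F p).1, (F p).2]%classic.
Proof.
move=> iA.
exists (fun p => (oapp ratr (inf A) p.1, oapp ratr (sup A) p.2)).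
apply/seteqP; split => [x Ax|x [p pA /pA//]].
have [l [lx Al]] : exists l : option rat, let a := oapp ratr (inf A) l in a <= x /\ A a.
  have [[y [Ay yx]]|noy] := pselect (exists y, A y /\ y < x).
    have [q] := rat_in_itvoo yx; rewrite in_itv/= => /andP[yq qx].
    by exists (Some q); split; [exact: ltW|apply: (iA y x) => //; rewrite !ltW].
  have lbx : lbound A x.
    by move=> y Ay; rewrite leNgt; apply/negP => yx; apply: noy; exists y.
  have xE : x = inf A.
    by apply/eqP; rewrite eq_le lb_le_inf ?ge_inf//; exists x.
  by exists None; rewrite /= -xE.
have [r [xr Ar]] : exists r : option rat, let b := oapp ratr (sup A) r in x <= b /\ A b.
  have [[y [Ay xy]]|noy] := pselect (exists y, A y /\ x < y).
    have [q] := rat_in_itvoo xy; rewrite in_itv/= => /andP[xq qy].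
    by exists (Some q); split; [exact: ltW|apply: (iA x y) => //; rewrite !ltW].
  have ubx : ubound A x.
    by move=> y Ay; rewrite leNgt; apply/negP => xy; apply: noy; exists y.
  have xE : x = sup A.
    by apply/eqP; rewrite eq_le ge_sup ?ub_le_sup//; exists x.
  by exists None; rewrite /= -xE.
exists (l, r) => /=; last by rewrite in_itv/= lx.
by move=> y /=; rewrite in_itv/=; exact: iA.
Qed.

Lemma normsq_ge0 (R : realType) (z : plane R) : 0 <= normsq z.
Proof. by rewrite addr_ge0 ?sqr_ge0. Qed.

Lemma normsq_eq0 (R : realType) (z : plane R) : (normsq z == 0) = (z == (0, 0)).
Proof. by case: z => x y; rewrite /normsq paddr_eq0 ?sqr_ge0// !sqrf_eq0. Qed.

Lemma modulus_gt0 (R : realType) (z : plane R) : (0 < modulus z) = (z != (0, 0)).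
Proof. by rewrite sqrtr_gt0 lt0r normsq_ge0 normsq_eq0 andbT. Qed.

(** The origin is excluded because it has no direction. *)
Definition cone (R : realType) (I : set (plane R)) : set (plane R) :=
  [set z | z != (0, 0) /\ I (direction z)].

Definition polar (R : realType) (p : R * R) : R * R :=
  (p.1 * cos p.2, p.1 * sin p.2).

Lemma continuous_polar (R : realType) : continuous (@polar R).
Proof.
move=> p; rewrite /continuous_at /polar.
have fstp : fst x @[x --> p] --> p.1 by exact: cvg_fst.
have sndp : snd x @[x --> p] --> p.2 by exact: cvg_snd.
have cx : x.1 * cos x.2 @[x --> p] --> p.1 * cos p.2.
  by apply: cvgM => //; apply: continuous_cvg => //; exact: continuous_cos.
have sx : x.1 * sin x.2 @[x --> p] --> p.1 * sin p.2.
  by apply: cvgM => //; apply: continuous_cvg => //; exact: continuous_sin.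
exact: cvg_pair cx sx.
Qed.

Lemma coneE (R : realType) (J : set R) :
  cone (@cis R @` J) = @polar R @` ([set r | 0 < r] `*` J).
Proof.
apply/seteqP; split => [z [z0 [t Jt zt]]|_ [[r t] [/= r0 Jt] <-]].
  have m0 : 0 < modulus z by rewrite modulus_gt0.
  exists (modulus z, t) => //; case: zt => c s; rewrite /polar/= c s.
  by case: z z0 m0 {c s} => x y z0 m0 /=; rewrite !(mulrC (modulus _)) !divfK// gt_eqF.
have mE : modulus (polar (r, t)) = r.
  rewrite /modulus /= !exprMn -mulrDr cos2Dsin2 mulr1 sqrtr_sqr gtr0_norm//.
split; first by rewrite -modulus_gt0 mE.
exists t => //; rewrite /direction mE /polar/=.
by rewrite !(mulrC r) !mulfK ?gt_eqF.
Qed.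

(** In polar coordinates the cone is ]0, +oo[ times an interval, a countable union
    of compact rectangles; their images are compact. Going through compact sets
    makes it unnecessary to discuss the argument of a complex number. *)
Lemma measurable_cone (R : realType) (J : set R) : is_interval J ->
  measurable (cone (@cis R @` J)).
Proof.
move=> /interval_bigcup_segment[F ->].
rewrite coneE.
have -> : [set r : R | 0 < r] = \bigcup_n `[n.+1%:R^-1, n.+1%:R]%classic.
  apply/seteqP; split => [r /= r0|r [n _]]; last first.
    by rewrite /= in_itv/= => /andP[+ _]; apply: lt_le_trans; rewrite invr_gt0.
  pose m := maxn (Num.truncn r) (Num.truncn r^-1).
  exists m => //=; rewrite in_itv/= invf_ple ?posrE//.
  apply/andP; split.
    by rewrite (le_trans (ltW (truncnS_gt _)))// ler_nat ltnS leq_maxr.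
  by rewrite (le_trans (ltW (truncnS_gt _)))// ler_nat ltnS leq_maxl.
set D := [set p | _].
have -> : @polar R @` ((\bigcup_n `[n.+1%:R^-1, n.+1%:R]%classic) `*`
    \bigcup_(p in D) `[(F p).1, (F p).2]%classic) =
  \bigcup_(n : nat) \bigcup_(p in D)
    @polar R @` (`[n.+1%:R^-1, n.+1%:R]%classic `*` `[(F p).1, (F p).2]%classic).
  apply/seteqP; split => [_ [[r t] [[n _ rn] [p Dp tp]] <-]|].
    by exists n => //; exists p => //; exists (r, t).
  move=> _ [n _ [p Dp [[r t] [rn tp] <-]]]; exists (r, t) => //.
  by split; [exists n|exists p].
apply: bigcup_measurable => n _.
rewrite bigcup_mkcond; apply: countable_bigcupT_measurable => // p.
case: ifPn => // _; apply: measurable_compact_plane.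
apply: continuous_compact.
  by apply: continuous_subspaceT; exact: continuous_polar.
by apply: compact_setX; exact: segment_compact.
Qed.

(** * Dilations *)

Lemma measurable_mulrl (R : realType) (k : R) :
  measurable_fun setT ( *%R k : measurableTypeR R -> measurableTypeR R).
Proof. by apply: measurable_funM => //; exact: measurable_cst. Qed.

Lemma lebesgue_measure_dilation (R : realType) (k : R)
    (A : set (measurableTypeR R)) : 0 < k -> measurable A ->
  lebesgue_measure ( *%R k @^-1` A) = (k^-1%:E * lebesgue_measure A)%E.
Proof.
move=> k0 mA.
pose m := mscale (NngNum (ltW k0))
  (pushforward (@lebesgue_measure R) ( *%R k : _ -> measurableTypeR R)).
have m_meas : measurable_fun setT ( *%R k : measurableTypeR R -> measurableTypeR R).
  exact: measurable_mulrl.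
suff -> : lebesgue_measure A = m m_meas A.
  by rewrite /m/= /mscale /pushforward/= muleA -EFinM mulVf ?mul1e// gt_eqF.
apply: lebesgue_measure_unique mA => _ [[a b] _ <-] /=.
rewrite /m /= /mscale/= /pushforward/=.
have -> : ( *%R k) @^-1` `]a, b] = `](a / k), (b / k)]%classic.
  apply/seteqP; split => x /=; rewrite !in_itv/=;
  by rewrite ltr_pdivrMr// ler_pdivlMr// mulrC.
rewrite !lebesgue_measure_itv/= !lte_fin ltr_pM2r ?invr_gt0//.
case: ifPn => _; last by rewrite mule0.
by rewrite -!EFinB -EFinM -mulrBl mulrCA divff ?mulr1// gt_eqF.
Qed.

Definition dilate (R : realType) (k : R) (z : plane R) : plane R :=
  (k * z.1, k * z.2).

Lemma measurable_dilate (R : realType) (k : R) : measurable_fun setT (dilate k).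
Proof.
apply/measurable_fun_pairP; split.
  exact: (measurableT_comp (measurable_mulrl k) measurable_fst).
exact: (measurableT_comp (measurable_mulrl k) measurable_snd).
Qed.

Lemma area_dilate (R : realType) (k : R) (A : set (plane R)) :
  0 < k -> measurable A -> area R (dilate k @^-1` A) = ((k ^- 2)%:E * area R A)%E.
Proof.
move=> k0 mA.
have mk := measurable_dilate k.
pose m := mscale (NngNum (sqr_ge0 k))
  (pushforward ((@lebesgue_measure R) \x (@lebesgue_measure R))%E (dilate k)).
have areaE B : area R B = ((pi^-1)%:E *
    ((@lebesgue_measure R) \x (@lebesgue_measure R)) B)%E by [].
rewrite !areaE.
suff -> : ((@lebesgue_measure R) \x (@lebesgue_measure R))%E A = m mk A.
  rewrite /m/= /mscale /pushforward/= muleCA; congr (_ * _)%E.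
  by rewrite muleA -EFinM mulVf ?mul1e// gt_eqF ?exprn_gt0.
apply: product_measure_unique mA => X Y mX mY.
transitivity ((k ^+ 2)%:E *
  ((@lebesgue_measure R) \x (@lebesgue_measure R))
    (( *%R k @^-1` X) `*` ( *%R k @^-1` Y)))%E; first by [].
have mkp (Z : set (measurableTypeR R)) : measurable Z -> measurable ( *%R k @^-1` Z).
  by move=> mZ; rewrite -[X in measurable X]setTI; exact: measurable_mulrl.
rewrite product_measure1E//; [|exact: mkp|exact: mkp].
rewrite [X in (_ * (X * _))%E](lebesgue_measure_dilation k0 mX).
rewrite [X in (_ * (_ * X))%E](lebesgue_measure_dilation k0 mY).
rewrite muleACA -EFinM [LHS]muleA -EFinM expr2.
rewrite (_ : (k * k * (k^-1 / k))%R = 1%R) ?mul1e//.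
by field; rewrite gt_eqF.
Qed.

(** * Integration over cones in the variable |z|^2 *)

Definition conic (R : realType) (C : set (plane R)) : Prop :=
  forall k z, 0 < k -> C z -> C (dilate k z).

Lemma normsq_dilate (R : realType) (k : R) (z : plane R) :
  normsq (dilate k z) = k ^+ 2 * normsq z.
Proof. by rewrite /normsq /= !exprMn mulrDr. Qed.

Lemma conic_cone (R : realType) (I : set (plane R)) : conic (cone I).
Proof.
move=> k z k0 [z0 Iz].
have mk : modulus (dilate k z) = k * modulus z.
  rewrite /modulus -/(normsq _) normsq_dilate sqrtrM ?sqr_ge0// sqrtr_sqr.
  by rewrite gtr0_norm.
split; first by rewrite -modulus_gt0 mk mulr_gt0// modulus_gt0.
by rewrite /direction mk /= -!mulf_div divff ?gt_eqF// !mul1r.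
Qed.

Lemma conicI (R : realType) (C D : set (plane R)) :
  conic C -> conic D -> conic (C `&` D).
Proof. by move=> cC cD k z k0 [Cz Dz]; split; [exact: cC|exact: cD]. Qed.

Lemma measurable_normsq (R : realType) :
  measurable_fun setT (@normsq R : plane R -> measurableTypeR R).
Proof.
by apply: measurable_funD; apply: measurable_funX;
  [exact: measurable_fst|exact: measurable_snd].
Qed.

Lemma discE (R : realType) : @disc R = @normsq R @^-1` `[0, 1[.
Proof.
apply/seteqP; split => z /=; rewrite in_itv/= normsq_ge0/=.
  by rewrite /disc/= -{1}sqrtr1 ltr_sqrt ?ltr01.
by move=> z1; rewrite /disc/= -sqrtr1 ltr_sqrt ?ltr01.
Qed.

Lemma measurable_normsq_preimage (R : realType) (E : set (measurableTypeR R)) :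
  measurable E -> measurable (@normsq R @^-1` E).
Proof.
by move=> mE; rewrite -[X in measurable X]setTI; exact: measurable_normsq.
Qed.

Lemma measurable_disc (R : realType) : measurable (@disc R).
Proof. by rewrite discE; exact: measurable_normsq_preimage. Qed.

Lemma area_disc_lty (R : realType) : (area R (@disc R) < +oo)%E.
Proof.
pose s : set (measurableTypeR R) := `[(-1)%R, 1%R]%classic.
have : @disc R `<=` s `*` s.
  rewrite discE /s => z /=; rewrite !in_itv/= normsq_ge0/= => z1.
  have sq_le1 (a : R) : a ^+ 2 <= 1 -> -1 <= a <= 1.
    by rewrite expr2 => a1; apply/andP; split; nra.
  split; apply: sq_le1; apply: le_trans (ltW z1); rewrite /normsq.
    by rewrite lerDl sqr_ge0.
  by rewrite lerDr sqr_ge0.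
move=> /(le_measure (area R)) sub; apply: le_lt_trans (sub _ _) _.
- by rewrite inE; exact: measurable_disc.
- by rewrite inE; apply: measurableX; exact: measurable_itv.
change (((pi^-1)%:E *
  ((@lebesgue_measure R) \x (@lebesgue_measure R)) (s `*` s) < +oo)%E).
rewrite product_measure1E; [|exact: measurable_itv..].
rewrite [X in (_ * (X * _))%E]lebesgue_measure_itv.
rewrite [X in (_ * (_ * X))%E]lebesgue_measure_itv.
by rewrite /= lte_fin gtrN//= -!EFinM ltry.
Qed.

Lemma area_sub_disc_fin (R : realType) (A : set (plane R)) :
  measurable A -> A `<=` @disc R -> area R A \is a fin_num.
Proof.
move=> mA AD; rewrite ge0_fin_numE//; apply: le_lt_trans (area_disc_lty R).
by apply: le_measure; rewrite ?inE//; exact: measurable_disc.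
Qed.

(** This is the homogeneity of area: the part of a cone in the disc of
    radius sqrt x is the dilate of the part in the unit disc. *)
Lemma area_conic_ball (R : realType) (C : set (plane R)) (x : R) :
  measurable C -> conic C -> 0 < x ->
  area R (C `&` normsq (R:=R) @^-1` `[0, x[) = (x%:E * area R (C `&` disc (R:=R)))%E.
Proof.
move=> mC cC x0.
have s0 : 0 < Num.sqrt x by rewrite sqrtr_gt0.
have -> : C `&` normsq (R:=R) @^-1` `[0, x[ =
    dilate (Num.sqrt x)^-1 @^-1` (C `&` disc (R:=R)).
  have inD z : disc (R:=R) (dilate (Num.sqrt x)^-1 z) <-> normsq z < x.
    rewrite discE/= in_itv/= normsq_ge0/= normsq_dilate exprVn sqr_sqrtr ?ltW//.
    by rewrite mulrC ltr_pdivrMr// mul1r.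
  apply/seteqP; split => z /= [Cz].
    rewrite in_itv/= normsq_ge0/= => zx; split; last exact/inD.
    by apply: cC => //; rewrite invr_gt0.
  move=> /inD zx; rewrite in_itv/= normsq_ge0/=; split => //.
  have -> : z = dilate (Num.sqrt x) (dilate (Num.sqrt x)^-1 z).
    by case: z {Cz zx} => a b; rewrite /dilate/= !mulrA divff ?gt_eqF// !mul1r.
  exact: cC.
rewrite area_dilate ?invr_gt0//; last by apply: measurableI => //; exact: measurable_disc.
by rewrite exprVn invrK sqr_sqrtr// ltW.
Qed.

(** The value -1 outside C is never a squared modulus, so that the image of the
    area of the whole plane by this function, restricted to [0, 1[, only sees
    points of C. *)
Definition conic_normsq (R : realType) (C : set (plane R)) (z : plane R) :
  measurableTypeR R := if z \in C then normsq z else -1.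

Lemma measurable_conic_normsq (R : realType) (C : set (plane R)) :
  measurable C -> measurable_fun setT (conic_normsq C).
Proof.
move=> mC; apply: measurable_fun_ifT => //; last exact: measurable_normsq.
apply: (@measurable_fun_bool _ _ _ _ true); rewrite setTI.
by rewrite (_ : _ @^-1` _ = C)//; apply/seteqP; split => z; [exact: set_mem|exact: mem_set].
Qed.

Lemma conic_normsq_preimage (R : realType) (C : set (plane R)) (E : set R) :
  E `<=` `[0, 1[%classic -> conic_normsq C @^-1` E = C `&` normsq (R:=R) @^-1` E.
Proof.
move=> E01; apply/seteqP; split => z /=; rewrite /conic_normsq.
  by case: ifPn => [/set_mem//|_ /E01/=]; rewrite in_itv/= ler0N1.
by move=> [Cz Ez]; rewrite mem_set.
Qed.

(** Both sides are finite measures in E; carried by [0, 1[, they agree by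
    homogeneity on the half-lines ]-oo, x[, which generate the Borel sets. *)
Lemma area_sector (R : realType) (C : set (plane R)) (E : set (measurableTypeR R)) :
  measurable C -> conic C -> measurable E -> E `<=` `[0, 1[%classic ->
  area R (C `&` normsq (R:=R) @^-1` E) =
    (area R (C `&` disc (R:=R)) * lebesgue_measure E)%E.
Proof.
move=> mC cC mE E01.
have sfin : area R (C `&` disc (R:=R)) \is a fin_num.
  apply: area_sub_disc_fin; last exact: subIsetr.
  by apply: measurableI => //; exact: measurable_disc.
have mphi := measurable_conic_normsq mC.
have m01 : measurable (`[0, 1[%classic : set (measurableTypeR R)) by [].
pose p := pushforward (area R) (conic_normsq C) :
  {measure set (measurableTypeR R) -> \bar R}.
pose m1 : {measure set (measurableTypeR R) -> \bar R} := mrestr (p mphi) m01.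
pose m2 : {measure set (measurableTypeR R) -> \bar R} :=
  mscale (NngNum (fine_ge0 (measure_ge0 (area R) (C `&` disc (R:=R)))))
   (mrestr (@lebesgue_measure R) m01).
have m2E A : m2 A = (area R (C `&` disc (R:=R)) * lebesgue_measure (A `&` `[0%R, 1%R[))%E.
  by rewrite -[in RHS](fineK sfin).
have m1E A : m1 A = area R (C `&` normsq (R:=R) @^-1` (A `&` `[0%R, 1%R[)).
  by rewrite -conic_normsq_preimage//; exact: subIsetr.
suff : m1 E = m2 E by rewrite m1E m2E (setIidl E01).
have cut (x : R) : `]-oo, x[ `&` `[0, 1[ = `[0, Num.min x 1[%classic :> set R.
  apply/seteqP; split => y /=; rewrite !in_itv/= lt_min.
    by case=> -> /andP[-> ->].
  by case/and3P => -> -> ->.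
apply: (@measure_unique _ R (measurableTypeR R) (@RGenInftyO.G R)
  (fun n : nat => `]-oo, n%:R[%classic) _ _ _ _ m1 m2 _ _ E mE) => //.
- exact: RGenInftyO.measurableE.
- move=> _ _ [x ->] [y ->]; exists (Num.min x y).
  by apply/seteqP; split => z /=; rewrite !in_itv/= lt_min; [case=> -> ->|case/andP].
- by move=> n; exists n%:R.
- rewrite -subTset => x _; exists (Num.truncn x).+1 => //=.
  by rewrite in_itv/= truncnS_gt.
- move=> _ [x ->]; rewrite m1E m2E !cut lebesgue_measure_itv/=.
  rewrite lte_fin; case: ifPn => [x0|]; last first.
    rewrite -leNgt => x0; rewrite set_itv_ge ?bnd_simp -?leNgt//.
    by rewrite preimage_set0 setI0 measure0 mule0.
  by rewrite area_conic_ball// oppr0 adde0 muleC.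
- move=> n; rewrite m1E cut; apply: le_lt_trans (area_disc_lty R).
  apply: le_measure; rewrite ?inE//; [|exact: measurable_disc|].
    by apply: measurableI => //; exact: measurable_normsq_preimage.
  rewrite discE => z [_] /=; rewrite !in_itv/= lt_min => /and3P[-> _ ->]//.
Qed.

Lemma integral_sector (R : realType) (C : set (plane R)) (E : set (measurableTypeR R))
    (g : measurableTypeR R -> \bar R) :
  measurable C -> conic C -> measurable E -> E `<=` `[0, 1[%classic ->
  measurable_fun E g -> (forall x, E x -> 0 <= g x)%E ->
  (\int[area R]_(z in C `&` normsq (R:=R) @^-1` E) g (normsq z) =
   area R (C `&` disc (R:=R)) * \int[lebesgue_measure]_(x in E) g x)%E.
Proof.
move=> mC cC mE E01 mg g0.
have sfin : area R (C `&` disc (R:=R)) \is a fin_num.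
  apply: area_sub_disc_fin; last exact: subIsetr.
  by apply: measurableI => //; exact: measurable_disc.
have mphi := measurable_conic_normsq mC.
rewrite -(conic_normsq_preimage _ E01).
transitivity (\int[area R]_(z in conic_normsq C @^-1` E) (g \o conic_normsq C) z)%E.
  apply: eq_integral => z; rewrite inE conic_normsq_preimage// => -[Cz _].
  by rewrite /= /conic_normsq mem_set.
rewrite -ge0_integral_pushforward//; last by move=> x /set_mem; exact: g0.
rewrite -[in RHS](fineK sfin).
pose s := NngNum (fine_ge0 (measure_ge0 (area R) (C `&` disc (R:=R)))).
rewrite -(@ge0_integral_mscale _ _ _ _ _ mE s)//.
apply: eq_measure_integral => A mA AE.
transitivity (area R (conic_normsq C @^-1` A)); first by [].
rewrite conic_normsq_preimage; last exact: subset_trans E01.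
rewrite area_sector//; last exact: subset_trans E01.
by rewrite -[in LHS](fineK sfin).
Qed.

(** * Averages of decreasing functions *)

(** The integral of a nonnegative function is a supremum over the simple functions
    below it, so it is monotone without any measurability. This matters for the
    maximal function. *)
Lemma le_integral_ge0 (d : measure_display) (T : measurableType d) (R : realType)
    (mu : {measure set T -> \bar R}) (D : set T) (f1 f2 : T -> \bar R) :
  (forall x, D x -> 0 <= f1 x)%E -> (forall x, D x -> f1 x <= f2 x)%E ->
  (\int[mu]_(x in D) f1 x <= \int[mu]_(x in D) f2 x)%E.
Proof.
move=> f10 f12.
have f20 x : D x -> (0 <= f2 x)%E by move=> Dx; exact: le_trans (f10 x Dx) (f12 x Dx).
rewrite !ge0_integralE//; apply: le_ereal_sup => _ [h hf <-]; exists h => // x.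
by apply: le_trans (hf x) _; exact: lee_restrict.
Qed.

(** For a < b this says that the mean of a decreasing function over ]b, 1[ is at
    most its mean over ]a, 1[. The latter is a barycentre of the means over
    ]a, b] and ]b, 1[, and the value at b separates these two means. *)
Lemma tail_integral_le (R : realType) (g : measurableTypeR R -> \bar R) (a b : R) :
  measurable_fun (`[0, 1[%classic : set (measurableTypeR R)) g ->
  (forall x : R, 0 <= x < 1 -> (0 <= g x)%E) ->
  (forall x y : R, 0 <= x -> x <= y -> y < 1 -> (g y <= g x)%E) ->
  0 <= a < 1 -> 0 <= b < 1 ->
  (\int[lebesgue_measure]_(x in `]Num.max a b, 1%R[) g x * (1 - a)%:E <=
   (1 - b)%:E * \int[lebesgue_measure]_(x in `]a, 1%R[) g x)%E.
Proof.
move=> mg g0 gd /andP[a0 a1] /andP[b0 b1].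
have tail0 c : 0 <= c -> (0 <= \int[lebesgue_measure]_(x in `]c, 1%R[) g x)%E.
  move=> c0; apply: integral_ge0 => x /=; rewrite in_itv/= => /andP[cx x1].
  by apply: g0; rewrite x1 (le_trans c0 (ltW cx)).
have [ba|ab] := leP b a.
  by rewrite muleC lee_wpmul2r ?tail0// lee_fin lerB.
have splitE : `]a, 1[%classic = `]a, b]%classic `|` `]b, 1[%classic :> set (measurableTypeR R).
  by rewrite -itv_bndbnd_setU// bnd_simp ltW.
rewrite splitE ge0_integral_setU//; last 3 first.
- rewrite -splitE; apply: measurable_funS mg => // x /=; rewrite !in_itv/=.
  by move=> /andP[ax ->]; rewrite (le_trans a0 (ltW ax)).
- move=> x; rewrite -splitE/= in_itv/= => /andP[ax x1]; apply: g0.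
  by rewrite x1 (le_trans a0 (ltW ax)).
- rewrite disj_set2E; apply/eqP; rewrite -subset0 => x [/=].
  by rewrite !in_itv/= => /andP[_ xb] /andP[bx _]; move: (le_lt_trans xb bx); rewrite ltxx.
have head0 : (0 <= \int[lebesgue_measure]_(x in `]a, b]) g x)%E.
  apply: integral_ge0 => x /=; rewrite in_itv/= => /andP[ax xb].
  by apply: g0; rewrite (le_trans a0 (ltW ax)) (le_lt_trans xb b1).
have gb0 : (0 <= g b)%E by apply: g0; rewrite b0.
have tail_le : (\int[lebesgue_measure]_(x in `]b, 1%R[) g x <= g b * (1 - b)%:E)%E.
  rewrite (_ : (1 - b)%:E =
    lebesgue_measure (`]b, 1%R[%classic : set (measurableTypeR R))); last first.
    by rewrite lebesgue_measure_itv/= lte_fin b1.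
  rewrite -integral_cst//; apply: le_integral_ge0 => x /=; rewrite in_itv/= => /andP[bx x1].
    by apply: g0; rewrite x1 (le_trans b0 (ltW bx)).
  by apply: gd => //; exact: ltW.
have head_ge : (g b * (b - a)%:E <= \int[lebesgue_measure]_(x in `]a, b]) g x)%E.
  rewrite (_ : (b - a)%:E =
    lebesgue_measure (`]a, b]%classic : set (measurableTypeR R))); last first.
    by rewrite lebesgue_measure_itv/= lte_fin ab.
  rewrite -integral_cst//; apply: le_integral_ge0 => x //=; rewrite in_itv/= => /andP[ax xb].
  by apply: gd => //; exact: le_trans a0 (ltW ax).
(* after splitting 1 - a, the products of the tail by 1 - b cancel *)
have -> : 1 - a = (b - a) + (1 - b) by ring.
rewrite EFinD ge0_muleDr ?lee_fin ?subr_ge0 ?(ltW ab) ?(ltW b1)//.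
rewrite ge0_muleDr ?tail0//; apply: leeD; last by rewrite muleC.
rewrite (le_trans (lee_wpmul2r _ tail_le)) ?lee_fin ?subr_ge0 ?(ltW ab)//.
rewrite muleAC muleC; apply: lee_wpmul2l => //.
by rewrite lee_fin subr_ge0 ltW.
Qed.

(** * Carleson squares *)

Lemma carleson_squareE (R : realType) (I : set (plane R)) : is_arc I ->
  exists2 a : R, 0 <= a < 1 &
    carleson_square I = cone I `&` normsq (R:=R) @^-1` `]a, 1[.
Proof.
move=> [_ I0].
have [m /andP[m0 m1] mI] : exists2 m : R, 0 <= m < 1 & forall r : R, 0 < r ->
    ((1 - r)%:E < arc_length I)%E = (m < r).
  move: I0; case: (arc_length I) => [h|_|//].
    (* the maximum covers h >= 1, where the condition on the radius is void *)
    rewrite lte_fin => h0; exists (Num.max 0 (1 - h)).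
      by rewrite le_max lexx/= gt_max ltr01/= ltrBlDr ltrDl.
    by move=> r r0; rewrite lte_fin gt_max r0/= ltrBlDr ltrBlDl addrC.
  exists 0; first by rewrite lexx ltr01.
  by move=> r r0; rewrite ltry r0.
exists (m ^+ 2); first by rewrite sqr_ge0 expr_lt1.
have modE (z : plane R) : (m < modulus z) = (m ^+ 2 < normsq z).
  have <- : modulus z ^+ 2 = normsq z by rewrite sqr_sqrtr ?normsq_ge0.
  by rewrite ltr_pXn2r ?nnegrE ?sqrtr_ge0.
apply/seteqP; split => z.
  move=> [dz z0 Iz]; rewrite mI ?modulus_gt0// modE => mz; split => //.
  by move: dz; rewrite discE/= !in_itv/= mz => /andP[].
move=> [[z0 Iz]]; rewrite /= in_itv/= -modE => /andP[mz z1].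
split=> //; last by rewrite mI// modulus_gt0.
by rewrite discE/= in_itv/= normsq_ge0.
Qed.

Lemma measurable_carleson_square (R : realType) (I : set (plane R)) :
  is_arc I -> measurable (carleson_square I).
Proof.
move=> aI; have [a _ ->] := carleson_squareE aI.
have [[J ->] _] := aI; apply: measurableI.
  by apply: measurable_cone; exact: interval_is_interval.
by apply: measurable_normsq_preimage; exact: measurable_itv.
Qed.

Lemma carleson_square_sub_disc (R : realType) (I : set (plane R)) :
  carleson_square I `<=` @disc R.
Proof. by move=> z []. Qed.

Lemma area_carleson_square_fin (R : realType) (I : set (plane R)) :
  is_arc I -> area R (carleson_square I) \is a fin_num.
Proof.
move=> aI; apply: area_sub_disc_fin; last exact: carleson_square_sub_disc.
exact: measurable_carleson_square.
Qed.

(** The comparison of the averages of w 1_{Q_I} over Q_J and of w over Q_I, cleared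
    of denominators. All four terms factor into an angular part, an area, and a
    radial part. The angular parts compare by monotonicity of the area, the radial
    ones by [tail_integral_le]. *)
Lemma decreasing_mass_le (R : realType) (w : plane R -> \bar R)
    (I J : set (plane R)) : decreasing w -> is_arc I -> is_arc J ->
  (\int[area R]_(z in carleson_square J `&` carleson_square I) w z
     * area R (carleson_square I) <=
   area R (carleson_square J) * \int[area R]_(z in carleson_square I) w z)%E.
Proof.
move=> [f [mf f0 fd wf]] aI aJ.
have mc (K : set (plane R)) : is_arc K -> measurable (cone K).
  by move=> [[L ->] _]; apply: measurable_cone; exact: interval_is_interval.
have [a /andP[a0 a1] QI] := carleson_squareE aI.
have [b /andP[b0 b1] QJ] := carleson_squareE aJ.
(* w as a function of the squared modulus *)
pose g (u : measurableTypeR R) := f (Num.sqrt u).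
have sqrt01 (x : R) : 0 <= x < 1 -> 0 <= Num.sqrt x < 1.
  by move=> /andP[x0 x1]; rewrite sqrtr_ge0/= -sqrtr1 ltr_sqrt// ltr01.
have g0 (x : R) : 0 <= x < 1 -> (0 <= g x)%E by move=> /sqrt01; exact: f0.
have gd (x y : R) : 0 <= x -> x <= y -> y < 1 -> (g y <= g x)%E.
  move=> x0 xy y1; apply: fd; rewrite ?sqrtr_ge0 ?ler_wsqrtr//.
  by have /sqrt01/andP[] : 0 <= y < 1 by rewrite (le_trans x0 xy).
have mg : measurable_fun (`[0, 1[%classic : set (measurableTypeR R)) g.
  apply: (measurable_comp _ _ mf) => //.
    by move=> _ [x /= + <-]; rewrite !in_itv/=; exact: sqrt01.
  apply: measurable_funTS; apply: continuous_measurable_fun.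
  exact: sqrt_continuous.
have sub01 (c : R) : 0 <= c ->
    (`]c, 1[%classic : set (measurableTypeR R)) `<=` `[0, 1[%classic.
  by move=> c0 x /=; rewrite !in_itv/= => /andP[/ltW/(le_trans c0)-> ->].
have intE (C : set (plane R)) (c : R) : measurable C -> conic C -> 0 <= c ->
    (\int[area R]_(z in C `&` normsq (R:=R) @^-1` `]c, 1%R[) w z =
     area R (C `&` disc (R:=R)) * \int[lebesgue_measure]_(x in `]c, 1%R[) g x)%E.
  move=> mC cC c0; rewrite -integral_sector//.
  - apply: eq_integral => z /set_mem[_ /(sub01 _ c0) z1]; apply: wf.
    by rewrite discE.
  - exact: sub01.
  - by apply: measurable_funS mg => //; exact: sub01.
  - by move=> x /(sub01 _ c0)/=; rewrite in_itv/=; exact: g0.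
have areaE (C : set (plane R)) (c : R) : measurable C -> conic C -> 0 <= c -> c < 1 ->
    area R (C `&` normsq (R:=R) @^-1` `]c, 1[) =
    (area R (C `&` disc (R:=R)) * (1 - c)%:E)%E.
  move=> mC cC c0 c1; rewrite area_sector//; last exact: sub01.
  by rewrite lebesgue_measure_itv/= lte_fin c1.
have -> : carleson_square J `&` carleson_square I =
    (cone J `&` cone I) `&` normsq (R:=R) @^-1` `]Num.max a b, 1[.
  rewrite QI QJ; apply/seteqP; split => z /=; rewrite !in_itv/= gt_max.
    by move=> [[Jz /andP[-> ->]] [Iz /andP[-> _]]].
  by move=> [[Jz Iz] /andP[/andP[-> ->] ->]].
have cI := conic_cone (I:=I); have cJ := conic_cone (I:=J).
have mI := mc _ aI; have mJ := mc _ aJ.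
have mJI : measurable (cone J `&` cone I) by exact: measurableI.
rewrite QI QJ !intE ?areaE ?le_max ?a0//; last exact: conicI.
(* angular factors first, radial factors second *)
rewrite muleACA [leRHS]muleACA.
apply: lee_pmul; last by apply: tail_integral_le; rewrite ?a0 ?b0.
- by rewrite mule_ge0.
- apply: mule_ge0; last by rewrite lee_fin subr_ge0 ltW.
  apply: integral_ge0 => x xab; apply: g0; suff : `[0, 1[%classic x by rewrite /= in_itv.
  by apply: sub01 xab; rewrite le_max a0.
- apply: lee_wpmul2r => //; apply: le_measure; rewrite ?inE//.
  + by apply: measurableI => //; exact: measurable_disc.
  + by apply: measurableI => //; exact: measurable_disc.
  + by move=> z [[Jz _] dz].
Qed.

(** The inverse of 0 is +oo here; an average over a null set is still harmless,
    because 0 * +oo = 0. *)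
Lemma mean_le_mean (R : realType) (P N p q : \bar R) :
  (0 <= N)%E -> (0 <= p)%E -> (0 <= q)%E -> p \is a fin_num -> q \is a fin_num ->
  (p = 0 -> P = 0)%E -> (q = 0 -> P = 0)%E ->
  (P * q <= p * N -> p^-1 * P <= q^-1 * N)%E.
Proof.
move=> N0 p0 q0 pf qf Pp Pq.
have [/Pp->|pn] := eqVneq p 0%E; first by rewrite mule0 mule_ge0 ?inve_ge0.
have [/Pq->|qn] := eqVneq q 0%E; first by rewrite mule0 mule_ge0 ?inve_ge0.
case: p q p0 q0 pn qn pf qf {Pp Pq} => // p [q| |]//.
rewrite !eqe !lee_fin => p0 q0 pn qn _ _ PN.
have {}p0 : 0 < p by rewrite lt_neqAle eq_sym pn.
have {}q0 : 0 < q by rewrite lt_neqAle eq_sym qn.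
by rewrite !inver (negbTE pn) (negbTE qn) lee_pdivrMl// muleCA muleC lee_pdivlMr.
Qed.

Lemma mean_mul_le (R : realType) (N q : \bar R) : (0 <= N)%E -> (0 <= q)%E ->
  q \is a fin_num -> (q^-1 * N * q <= N)%E.
Proof.
case: q => // q N0 _ _; rewrite inver.
have [->|q0] := eqVneq q 0; first by rewrite mule0.
by rewrite muleAC -EFinM mulVf// mul1e.
Qed.

Lemma carleson_average_le (R : realType) (w : plane R -> \bar R)
    (I J : set (plane R)) : measurable_fun (disc (R:=R)) w ->
  (forall z, disc z -> (0 <= w z)%E) -> decreasing w -> is_arc I -> is_arc J ->
  (carleson_average (w \_ (carleson_square I)) J <=
   (area R (carleson_square I))^-1 *
     \int[area R]_(z in carleson_square I) w z)%E.
Proof.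
move=> mw w0 dw aI aJ.
have mQI := measurable_carleson_square aI.
have mQJ := measurable_carleson_square aJ.
have sI := @carleson_square_sub_disc R I.
have sJ := @carleson_square_sub_disc R J.
have mwIJ : measurable_fun (carleson_square J `&` carleson_square I) w.
  by apply: measurable_funS mw; [exact: measurable_disc|move=> z [/sJ]].
have null (K : set (plane R)) : measurable K -> area R K = 0%E ->
    carleson_square J `&` carleson_square I `<=` K ->
    (\int[area R]_(z in carleson_square J `&` carleson_square I) w z = 0)%E.
  move=> mK K0 sub; have mQ := measurableI _ _ mQJ mQI.
  apply: (null_set_integral mQ mwIJ); exact: subset_measure0 sub K0.
rewrite /carleson_average.
have -> : (\int[area R]_(z in carleson_square J) `|(w \_ (carleson_square I)) z| =
    \int[area R]_(z in carleson_square J `&` carleson_square I) w z)%E.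
  rewrite integral_mkcondr; apply: eq_integral => z _; rewrite gee0_abs//.
  by apply: erestrict_ge0 => y /sI; exact: w0.
apply: mean_le_mean.
- by apply: integral_ge0 => z /sI; exact: w0.
- exact: measure_ge0.
- exact: measure_ge0.
- exact: area_carleson_square_fin.
- exact: area_carleson_square_fin.
- by move=> QJ0; apply: null mQJ QJ0 _; exact: subIsetl.
- by move=> QI0; apply: null mQI QI0 _; exact: subIsetr.
- exact: decreasing_mass_le.
Qed.

(** * Decreasing weights *)

Theorem proposition3p6 (R : realType) (w : plane R -> \bar R)
    (weight_w : weight w) (decreasing_w : decreasing w)
    (w0_gt0 : (0 < w (0%R, 0%R))%E) (w0_fin : (w (0%R, 0%R) < +oo)%E) :
  B_infty w.
Proof.
have [mw w0 _] := weight_w.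
have d0 : disc ((0, 0) : plane R).
  by rewrite discE/= in_itv/= /normsq/= expr0n/= addr0 lexx ltr01.
split=> //.
  apply/integrableP; split => //.
  have wle z : disc z -> (w z <= w (0%R, 0%R))%E.
    have [f [_ _ fd wf]] := decreasing_w.
    move=> dz; rewrite !wf//; apply: fd => //; rewrite ?sqrtr_ge0//.
    by rewrite /modulus/= expr0n/= addr0 sqrtr0 sqrtr_ge0.
  apply: (@le_lt_trans _ _ (\int[area R]_(z in disc (R:=R)) cst (w (0%R, 0%R)) z)%E).
    apply: le_integral_ge0 => z dz//.
    by rewrite gee0_abs ?wle ?w0.
  rewrite integral_cst; last exact: measurable_disc.
  by apply: lte_mul_pinfty; [exact: ltW|rewrite ge0_fin_numE ?ltW|exact: area_disc_lty].
exists 1 => // I aI; rewrite /= mul1e; set Q := carleson_square I.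
have wQ0 : (0 <= \int[area R]_(z in Q) w z)%E.
  by apply: integral_ge0 => z /carleson_square_sub_disc; exact: w0.
set c := ((area R Q)^-1 * \int[area R]_(z in Q) w z)%E.
have c0 : (0 <= c)%E by rewrite mule_ge0// inve_ge0.
have maxle z : (maximal (w \_ Q) z <= c)%E.
  apply: ge_ereal_sup => _ [->//|[J [aJ _] <-]].
  exact: carleson_average_le.
apply: (@le_trans _ _ (\int[area R]_(z in Q) cst c z)%E).
  apply: le_integral_ge0 => z _ //.
  by apply: ereal_sup_ubound; left.
rewrite integral_cst; last exact: measurable_carleson_square.
by apply: mean_mul_le => //; exact: area_carleson_square_fin.
Qed.
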